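(* Assume the Continuum Hypothesis. Then $\mathbb{H}^*$ is a universal continuum of weight $\mathfrak{c}$; that is, $\mathbb{H}^*$ is a continuum of weight $\mathfrak{c}$, and every continuum of weight $\mathfrak{c}$ is a continuous image of $\mathbb{H}^*$.
   Context: A continuum is a (nonempty) compact connected Hausdorff space. The weight of a space is the least cardinality of a base for its topology, and $\mathfrak{c}=2^{\aleph_0}$. $\mathbb{H}=[0,\infty)$ is the half line with its usual topology, and $\mathbb{H}^*=\beta\mathbb{H}\setminus\mathbb{H}$ is its Čech–Stone remainder. ''Universal'' is meant in the sense of mapping onto, not embedding. *)

(* Defs.v *)
From HB Require Import structures.
From mathcomp Require Import all_boot all_order all_algebra.
From mathcomp Require Import all_classical all_reals.
From mathcomp Require Import topology function_spaces normedtype.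
Set Implicit Arguments.
Unset Strict Implicit.
Unset Printing Implicit Defensive.
Import Order.TTheory GRing.Theory Num.Theory.
Import numFieldNormedType.Exports.
Local Open Scope classical_set_scope.
Local Open Scope card_scope.

Definition continuum (T : topologicalType) : Prop :=
  [/\ [set: T] !=set0, compact [set: T], connected [set: T]
    & hausdorff_space T].

(** A cardinal is represented by a set [K] having that cardinality, in any
    carrier type. *)
Definition has_weight (T : topologicalType) (U : Type) (K : set U) : Prop :=
  (exists2 B : set (set T), basis B & B #= K) /\
  (forall B : set (set T), basis B -> K #<= B).

(** [2 ^ aleph_0], as the power set of [nat]. *)
Definition continuum_card : set (set nat) := [set: set nat].

Definition continuum_hypothesis : Prop :=
  forall A : set (set nat), countable A \/ A #= continuum_card.

Definition universal_continuum (U : Type) (K : set U) (T : topologicalType)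
    : Prop :=
  [/\ continuum T, has_weight T K
    & forall Y : topologicalType, continuum Y -> has_weight Y K ->
        exists2 f : T -> Y, continuous f & range f = [set: Y]].

Section StoneCech.
Variables (R : realType) (X : topologicalType).

Definition unit_interval : topologicalType := set_type `[0%R : R, 1%R]%classic.

Definition cube : topologicalType :=
  {ptws continuousType X unit_interval -> unit_interval}.

Definition evaluation : X -> cube :=
  join_product (fun (f : continuousType X unit_interval) (x : X) => f x).

(** For a Tychonoff space [X], [evaluation] is an embedding and the closure of
    its range is the Cech-Stone compactification of [X]. *)
Definition stone_cech : set cube := closure (range evaluation).

Definition stone_cech_remainder : topologicalType :=
  set_type (stone_cech `\` range evaluation).

End StoneCech.

Definition half_line (R : realType) : topologicalType :=
  set_type `[0%R : R, +oo[%classic.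

Definition half_line_remainder (R : realType) : topologicalType :=
  stone_cech_remainder R (half_line R).

(* Main.v *)
Require Import Defs.
From HB Require Import structures.
From mathcomp Require Import all_boot all_order all_algebra.
From mathcomp Require Import lra.
From mathcomp Require Import all_classical all_reals.
From mathcomp Require Import wochoice.
From mathcomp Require Import topology function_spaces normedtype.

(** The remainder is the intersection of the closures, in the cube, of the
    tails of the half line ([remainderP]). So it is a decreasing intersection of
    continua, hence a continuum. A continuous function on the half line is
    determined by the comparisons of its values at rational points with rational
    numbers, so the rational boxes of the cube form a basis of at most continuum
    many sets; and an almost disjoint family of continuum many sets of natural
    numbers yields as many disjoint nonempty open sets ([bump_region]), so no
    basis is smaller.

    Let [Y] be a continuum whose weight is at most the cardinality of the power
    set of [nat], and [y0] one of its points. Continuum many functions [f k]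
    from [Y] to the unit interval with [f k y0 = 0] separate the points of [Y]
    ([separating_family]), and [Y] may be identified with its image in a product
    of unit intervals. As [Y] is
    connected, in any finitely many coordinates there are loops at the origin
    that stay close to this image and pass through any given finite set of its
    points ([loops_through]). Suppose that for each coordinate [k] a sequence of
    loops [h k n] is given such that, for any finitely many coordinates, the
    loops of rank [n] eventually avoid each rational box whose closure misses
    [Y], and eventually visit each one that meets [Y]. Running through the loops
    one after the other defines for each [k] a function on the half line, hence
    on the remainder; by the first property the values of these functions at a
    point of the remainder are the coordinates of a point of [Y]
    ([remainder_value]), and by the second one every point of [Y] is obtained
    ([remainder_value_onto]).

    The difficulty is to choose continuum many sequences of loops, as those
    chosen first may not fit with any choice of the next one: loops close to a
    circle need not lift to a space that maps onto it. The remedy is to choose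
    the loops so that they resemble generic ones much more closely. Families of
    loops with the above properties for larger and larger finite sets of
    conditions generate a filter, and a property in this filter is regarded as a
    generic one. The sequences are constructed so that not only the basic
    properties but all the positive existential formulas built from them hold
    eventually if they hold generically. As an existential quantifier is just a
    request for one more loop, such a construction can always be continued, and
    since there are only countably many formulas a diagonal choice satisfies
    them all, as long as only countably many sequences have been chosen before
    ([good_extend], [coherent_sequences]). By the continuum hypothesis the
    coordinates have a well-order in which every initial segment is countable
    ([ch_order]). *)

Set Implicit Arguments.
Unset Strict Implicit.
Unset Printing Implicit Defensive.
Import Order.TTheory GRing.Theory Num.Theory.
Import numFieldNormedType.Exports.
Local Open Scope classical_set_scope.

(** * Positive existential formulas *)

Section Formulas.
Variables (P : Type) (A : nat -> set (nat -> P)).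

Definition finitely_determined (S : set (nat -> P)) :=
  exists k, forall v w, (forall i, (i < k)%N -> v i = w i) -> S v -> S w.

(** Positive existential formulas over the basic properties [A], with variables
    indexed by [nat]. There is no negation or universal quantifier because the
    construction below has to transfer formulas along a filter that need not
    be maximal. [Rename] is a constructor so that a change of variables never
    requires a syntactic substitution; its list stands for the variable map
    sending [i] to the [i]-th entry, and to [0] past the end. *)
Inductive formula :=
| Top
| Atom of nat
| Conj of formula & formula
| Ex of formula
| Rename of seq nat & formula.

Definition extend T (x : T) (v : nat -> T) (n : nat) : T :=
  if n is m.+1 then v m else x.

Fixpoint sat (phi : formula) : set (nat -> P) :=
  match phi with
  | Top => setT
  | Atom a => A a
  | Conj f g => sat f `&` sat g
  | Ex f => [set v | exists p, sat f (extend p v)]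
  | Rename r f => [set v | sat f (fun n => v (nth 0%N r n))]
  end.

(** This is what allows an arbitrary map of variables to be replaced by the
    finite one of [Rename], and infinitely many parameters by finitely many. *)
Lemma sat_finitely_determined :
  (forall a, finitely_determined (A a)) ->
  forall phi, finitely_determined (sat phi).
Proof.
move=> finA; elim=> [|a|f [k kf] g [l lg]|f [k kf]|r f [k kf]] /=.
- by exists 0%N.
- exact: finA.
- exists (maxn k l) => v w vw [fv gv]; split.
    by apply: kf fv => i ik; rewrite vw// leq_max ik.
  by apply: lg gv => i il; rewrite vw// leq_max il orbT.
- exists k => v w vw [p fp]; exists p; apply: kf fp => -[//|i] ik /=.
  by rewrite vw// ltnW.
- have [m rm] : exists m, forall i, (nth 0 r i <= m)%N.
    elim: r => [|j r [m rm]]; first by exists 0%N => i; rewrite nth_nil.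
    by exists (maxn j m) => -[|i] /=; rewrite leq_max ?leqnn// rm orbT.
  exists m.+1 => v w vw /=; apply: kf => i _.
  by rewrite vw// ltnS.
Qed.

Fixpoint code (phi : formula) : GenTree.tree (seq nat) :=
  match phi with
  | Top => GenTree.Node 0 [::]
  | Atom a => GenTree.Node 1 [:: GenTree.Leaf [:: a]]
  | Conj f g => GenTree.Node 2 [:: code f; code g]
  | Ex f => GenTree.Node 3 [:: code f]
  | Rename r f => GenTree.Node 4 [:: GenTree.Leaf r; code f]
  end.

Fixpoint decode (t : GenTree.tree (seq nat)) : formula :=
  match t with
  | GenTree.Node 1 [:: GenTree.Leaf r] => Atom (head 0%N r)
  | GenTree.Node 2 [:: t; u] => Conj (decode t) (decode u)
  | GenTree.Node 3 [:: t] => Ex (decode t)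
  | GenTree.Node 4 [:: GenTree.Leaf r; t] => Rename r (decode t)
  | _ => Top
  end.

Lemma codeK : cancel code decode.
Proof. by elim=> //= [f -> g ->|f ->|r f ->]. Qed.

Lemma formula_enum : exists u : nat -> formula, forall phi, exists n, u n = phi.
Proof.
exists (fun n => if unpickle n is Some t then decode t else Top) => phi.
by exists (pickle (code phi)); rewrite pickleK codeK.
Qed.

End Formulas.

Arguments formula : clear implicits.

(** * Coherent sequences along a well-order *)

Section CoherentSequences.
Variables (P : Type) (p0 : P) (A : nat -> set (nat -> P)).
Hypothesis finA : forall a, finitely_determined (A a).
Variables (K : choiceType) (F : set_system (K -> P)).
Context {FF : ProperFilter F}.

(** The variable [n] stands for the value of [p] at the index [e n]; where
    [e n] is [None] it stands for [p0], so that there are valuations with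
    parameters in the empty set of indices. *)
Definition valuation (p : K -> P) (e : nat -> option K) (n : nat) : P :=
  oapp p p0 (e n).

(** The induction hypothesis of the construction. A set in the filter [F] is
    thought of as a property of the generic [p]: all positive existential
    facts about the generic [p] at indices in [D] hold for almost all the
    approximations [h^~ n]. Asking this for the basic facts alone would not
    survive the addition of an index. *)
Definition good (h : K -> nat -> P) (D : set K) :=
  forall phi (e : nat -> option K), (forall i k, e i = Some k -> D k) ->
  F [set p | sat A phi (valuation p e)] ->
  \forall n \near \oo, sat A phi (valuation (h^~ n) e).

Lemma good_eq h h' D : (forall k, D k -> h k = h' k) -> good h D -> good h' D.
Proof.
move=> hh' gh phi e eD /(gh _ _ eD); apply: filterS => n.
congr (sat A phi _); apply/funext => i; rewrite /valuation.
by case ei: (e i) => [k|//] /=; rewrite hh'//; apply: eD ei.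
Qed.

(** Take a point of the last nonempty set among those of index at most [n]. *)
Lemma diagonal_witness (S : nat -> set P) : (forall m, S m.+1 `<=` S m) ->
  forall n, exists p, forall m, (m <= n)%N -> S m !=set0 -> S m p.
Proof.
move=> Sdec; have {}Sdec m k : (m <= k)%N -> S k `<=` S m.
  elim: k => [|k IH]; first by rewrite leqn0 => /eqP->.
  by rewrite leq_eqVlt => /predU1P[->//|/IH mk]; apply: subset_trans mk.
elim=> [|n [p IH]].
  have [[p Sp]|S0] := pselect (S 0%N !=set0); last first.
    by exists p0 => m; rewrite leqn0 => /eqP->.
  by exists p => m; rewrite leqn0 => /eqP->.
have [[q Sq]|S0] := pselect (S n.+1 !=set0).
  by exists q => m mn _; apply: Sdec Sq.
exists p => m; rewrite leq_eqVlt => /predU1P[->//|]; exact: IH.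
Qed.

(** One more index [a] can be added to a countable set [D]. The generic facts
    about [a] and [D] can be listed, since there are countably many formulas;
    if [Phi m] is the conjunction of the first [m] of them, then [Ex (Phi m)]
    is a generic fact about [D], hence true of [h^~ n] for all large [n]. So
    the value at [a] of the [n]-th approximation can be a witness of [Phi m]
    with [m] as large as possible, and then each listed fact holds from some
    [n] on. *)
Lemma good_extend h D a : countable D -> good h D ->
  exists x : nat -> P, forall h', (forall k, D k -> h' k = h k) -> h' a = x ->
    good h' (D `|` [set a]).
Proof.
move=> /countable_injP[c cinj] gh.
have [u uP] := formula_enum.
(* [e0] lists [None] and all of [D]; [e1] has [a] in front. *)
pose e0 := extend None (fun n =>
  if pselect (exists2 k, D k & c k = n) is left H then Some (sval (cid2 H)) else None).
have e0D i k : e0 i = Some k -> D k.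
  by case: i => //= i; case: pselect => // H [<-]; case: cid2.
have e0N : e0 0%N = None by [].
have e0S k : D k -> exists i, e0 i = Some k.
  move=> Dk; exists (c k).+1 => /=; case: pselect => [H|[]]; last by exists k.
  by congr Some; case: cid2 => /= l Dl clk; apply: cinj; rewrite ?inE.
pose e1 := extend (Some a) e0.
have val1 p : valuation p e1 = extend (p a) (valuation p e0).
  by apply/funext => -[].
pose true1 phi := F [set p | sat A phi (valuation p e1)].
pose only_true j := if pselect (true1 (u j)) then u j else Top.
have filter_true j : true1 (only_true j).
  by rewrite /only_true; case: pselect => //= _; exact: filterT.
pose Phi := fix Phi m := if m is j.+1 then Conj (only_true j) (Phi j) else Top.
have Phi_true m : true1 (Phi m).
  elim: m => [|m IH]; first exact: filterT.
  exact: filterI (filter_true m) IH.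
have ExPhi m : \forall n \near \oo, sat A (Ex (Phi m)) (valuation (h^~ n) e0).
  apply: gh => //; apply: filterS (Phi_true m) => p.
  by rewrite /= val1 => ?; exists (p a).
pose S n m := [set p | sat A (Phi m) (extend p (valuation (h^~ n) e0))].
have Sdec n m : S n m.+1 `<=` S n m by move=> p [].
pose x n := sval (cid (diagonal_witness (Sdec n) n)).
exists x => h' h'h h'a phi e eDa Fphi.
have val0 n : valuation (h'^~ n) e0 = valuation (h^~ n) e0.
  apply/funext => i; rewrite /valuation.
  by case ei: (e0 i) => [k|//] /=; rewrite h'h//; apply: e0D ei.
have val1' n : valuation (h'^~ n) e1 = extend (x n) (valuation (h^~ n) e0).
  by rewrite val1 h'a val0.
have good1 psi : true1 psi ->
    \forall n \near \oo, sat A psi (valuation (h'^~ n) e1).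
  have [j <-] := uP psi; move=> Tj; near=> n.
  have : S n j.+1 (x n).
    rewrite /x; case: cid => p /= pP; apply: pP.
      by near: n; exact: nbhs_infty_ge.
    by near: n; apply: filterS (ExPhi j.+1) => n [q ?]; exists q.
  by rewrite val1' /S /= /only_true; case: pselect => //= _ [].
(* Any other valuation in [D] and [a] is a change of variables of [e1]. *)
have /choice[r rP] : forall i, exists j, e1 j = e i.
  move=> i; case ei: (e i) => [k|]; last by exists 1%N.
  have [/e0S[j <-]|->] := eDa _ _ ei; [by exists j.+1|by exists 0%N].
have [k kP] := sat_finitely_determined finA phi.
have satE p : sat A (Rename (mkseq r k) phi) (valuation p e1) <->
    sat A phi (valuation p e).
  by split=> /=; apply: kP => i ik; rewrite nth_mkseq// /valuation rP.
have : true1 (Rename (mkseq r k) phi) by apply: filterS Fphi => p /satE.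
by move=> /good1; apply: filterS => n /satE.
Unshelve. all: by end_near. Qed.

Variable (lt : K -> K -> Prop).
Hypotheses (wflt : well_founded lt)
  (lt_trans : forall a b c, lt a b -> lt b c -> lt a c)
  (lt_total : forall a b, [\/ lt a b, a = b | lt b a])
  (lt_countable : forall a, countable [set b | lt b a]).

Let below a := [set b | lt b a].
Let upto a := below a `|` [set a].

(** Goodness is of finite character, and finitely many indices have a largest
    one. With no index at all, a generic fact is simply a true statement. *)
Lemma good_limit h D : (forall b, D b -> good h (upto b)) -> good h D.
Proof.
move=> gh phi e eD Fphi.
have [k kP] := sat_finitely_determined finA phi.
pose e' i := if (i < k)%N then e i else None.
have satE p : sat A phi (valuation p e') <-> sat A phi (valuation p e).
  by split; apply: kP => i ik; rewrite /valuation /e' ik.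
have Fphi' : F [set p | sat A phi (valuation p e')].
  by apply: filterS Fphi => p /satE.
suff : \forall n \near \oo, sat A phi (valuation (h^~ n) e').
  by apply: filterS => n /satE.
have [e'N|[b Db e'b]] : (forall i, e' i = None) \/
    exists2 b, D b & forall i c, e' i = Some c -> upto b c.
  rewrite /e'; elim: k {kP e' satE Fphi'} => [|k [IH|[b Db IH]]]; first by left.
  - case ek: (e k) => [c|]; [right|left] => [|i].
      exists c => [|i c']; first exact: eD ek.
      rewrite ltnS leq_eqVlt; have [->|ik] := eqVneq i k.
        by rewrite ek => -[<-]; right.
      by rewrite IH.
    rewrite ltnS leq_eqVlt; have [->|ik] := eqVneq i k; first by rewrite ek.
    exact: IH.
  - right; case ek: (e k) => [c|]; last first.
      exists b => // i c'; rewrite ltnS leq_eqVlt.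
      have [->|ik] := eqVneq i k; [by rewrite ek|exact: IH].
    have [m [Dm bm cm]] : exists m, [/\ D m, upto b `<=` upto m & upto m c].
      have Dc := eD _ _ ek.
      have [bc|<-|cb] := lt_total b c.
      - exists c; split=> //; last by right.
        by move=> z [zb|->]; left; rewrite /below/= ?bc//; apply: lt_trans bc.
      - by exists b; split=> //; right.
      - by exists b; split=> //; left.
    exists m => // i c'; rewrite ltnS leq_eqVlt.
    have [->|ik] := eqVneq i k; first by rewrite ek => -[<-].
    by move=> /IH /bm.
- have [p] := filter_ex Fphi'; rewrite /= => satp; apply: nearW => n.
  suff <- : valuation p e' = valuation (h^~ n) e' by [].
  by apply/funext => i; rewrite /valuation e'N.
- exact: gh Db _ _ e'b Fphi'.
Qed.

(** The values [h a] are chosen by recursion on [a]: [good_limit] provides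
    goodness strictly below [a], and [good_extend] extends it to [a]. *)
Theorem coherent_sequences : exists h : K -> nat -> P,
  forall a (e : nat -> K), F [set p | A a (fun i => p (e i))] ->
  \forall n \near \oo, A a (fun i => h (e i) n).
Proof.
pose cut (a : K) (h : K -> nat -> P) k :=
  if pselect (lt k a) is left _ then h k else fun=> p0.
pose extension (a : K) (h : K -> nat -> P) := [set x | forall h' : K -> nat -> P,
  (forall k, below a k -> h' k = h k) -> h' a = x ->
  good h' (below a `|` [set a])].
pose next a h : nat -> P :=
  if pselect (extension a h !=set0) is left H then sval (cid H) else fun=> p0.
pose step (a : K) (rec : forall k, lt k a -> nat -> P) := next a
  (fun k => if pselect (lt k a) is left H then rec k H else fun=> p0).
pose h := Fix wflt (fun=> nat -> P) step.
have hE a : h a = next a (cut a h).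
  rewrite {1}/h Fix_eq// => b f g fg; rewrite /step; congr next.
  by apply/funext => k; case: pselect.
have good_upto : forall a, good h (upto a).
  apply: (well_founded_ind wflt) => a /good_limit gh.
  have cutE k : below a k -> h k = cut a h k by rewrite /cut; case: pselect.
  have ext : extension a (cut a h) !=set0.
    exact: good_extend (lt_countable a) (good_eq cutE gh).
  have : extension a (cut a h) (h a).
    by rewrite hE /next; case: pselect => // H /=; case: cid.
  exact.
have gh : good h setT by apply: good_limit => b _.
exists h => a e Fa; exact: (gh (Atom a) (Some \o e)).
Qed.

End CoherentSequences.

(** * The continuum hypothesis as a well-order *)

Section WellOrder.
Local Open Scope card_scope.

Lemma strict_well_order (T : choiceType) : exists lt : T -> T -> Prop,
  [/\ well_founded lt, forall a b c, lt a b -> lt b c -> lt a c &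
      forall a b, [\/ lt a b, a = b | lt b a]].
Proof.
have [R woR] := well_ordering_principle T.
pose lt x y := ~~ R y x.
have least (S : set T) : S !=set0 -> exists2 z, S z & forall x, S x -> R z x.
  move=> [x Sx]; have [|z [[zS zmin] _]] := woR (mem S).
    by exists x; rewrite inE.
  by exists z => [|y Sy]; [rewrite inE in zS|apply: zmin; rewrite inE].
have wf : well_founded lt.
  move=> a; apply: contrapT => Na.
  have [z Nz zmin] : exists2 z, ~ Acc lt z & forall x, ~ Acc lt x -> R z x.
    by apply: (least [set z | ~ Acc lt z]); exists a.
  apply: Nz; constructor => y yz; apply: contrapT => Ny.
  by move: yz; rewrite /lt zmin.
have total a b : [\/ lt a b, a = b | lt b a].
  rewrite /lt; have [Rba|_] := boolP (R b a); last by constructor.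
  have [Rab|_] := boolP (R a b); last by constructor.
  have [|z [_ zuniq]] := woR (mem [set a; b]); first by exists a; rewrite inE; left.
  have mem2 x : x \in mem [set a; b] = ((x == a) || (x == b)).
    apply/idP/idP; first by rewrite inE => -[->|->]; rewrite eqxx ?orbT.
    by move=> /orP[] /eqP->; rewrite inE; [left|right].
  have refl x : R x x.
    have [y Sy ymin] := least [set x] (ex_intro _ x erefl).
    by rewrite -{1}Sy; apply: ymin.
  constructor 2; transitivity z; [symmetry|]; apply: zuniq; split;
    rewrite ?mem2 ?eqxx ?orbT// => y; rewrite mem2 => /orP[] /eqP-> //.
exists lt; split=> // a b c ab bc.
have [//|ac|ca] := total a c.
  have [z Sz zmin] := least [set a; b] (ex_intro _ a (or_introl erefl)).
  move: ab bc; rewrite -ac /lt.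
  by case: Sz => /= za; rewrite -!za zmin//=; [right|left].
have [|z Sz zmin] := least [set x | [\/ x = a, x = b | x = c]].
  by exists a; constructor.
move: ab bc ca; rewrite /lt.
by case: Sz => <-; rewrite zmin//=; constructor.
Qed.

(** If some initial segment of a well-order of [set nat] is uncountable, take
    the least element with such a segment. By the continuum hypothesis
    [set nat] embeds in that segment, and the order pulled back along the
    embedding has countable initial segments. *)
Lemma ch_order : continuum_hypothesis ->
  exists lt : set nat -> set nat -> Prop,
  [/\ well_founded lt, forall a b c, lt a b -> lt b c -> lt a c,
      forall a b, [\/ lt a b, a = b | lt b a] &
      forall a, countable [set b | lt b a]].
Proof.
move=> CH; have [R [wfR transR totalR]] := strict_well_order (set nat).
have [g ginj gcountable] : exists2 g : set nat -> set nat, injective g &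
    forall a, countable [set b | R b (g a)].
  have [allc|] := pselect (forall a, countable [set b | R b a]).
    by exists id => // a b.
  move=> /existsNP[a]; elim/(well_founded_ind wfR): a => a IH Na.
  have [[b ba Nb]|allc] := pselect (exists2 b, R b a & ~ countable [set c | R c b]).
    exact: IH Nb.
  have : continuum_card #<= [set b | R b a].
    by have [//|] := CH [set b | R b a]; rewrite card_eq_le => /andP[].
  move=> /pcard_leP/injfunPex[g gR ginj]; exists g => [x y gxy|x].
    by apply: ginj; rewrite ?inE.
  by apply: contrapT => Nx; apply: allc; exists (g x) => //; exact: gR.
exists (fun a b => R (g a) (g b)); split.
- move=> a; move: {2}(g a) (erefl (g a)) => x; move: a.
  elim/(well_founded_ind wfR): x => x IH a gax; constructor => b.
  by rewrite gax => Rbx; apply: (IH _ Rbx).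
- by move=> a b c; exact: transR.
- move=> a b; have [?|/ginj->|?] := totalR (g a) (g b).
  + by constructor.
  + by constructor.
  + by constructor.
- move=> a; apply: sub_countable (gcountable a).
  by apply/pcard_leP/injfunPex; exists g => // x y _ _ /ginj.
Qed.

End WellOrder.

(** * Loops near the image of a continuum *)

Local Open Scope ring_scope.

Section Loops.
Variable R : realType.

Definition clamp (x : R) : R := Num.max 0 (Num.min 1 x).

Lemma clampP x : [\/ x <= 0 /\ clamp x = 0, 0 <= x <= 1 /\ clamp x = x
  | 1 <= x /\ clamp x = 1].
Proof.
rewrite /clamp; have [x1|x1] := leP 1 x.
  by constructor 3; rewrite max_r ?ler01.
have [x0|x0] := leP 0 x; first by constructor 2; rewrite ltW.
by constructor 1; rewrite ltW.
Qed.

Lemma clamp_itv x : 0 <= clamp x <= 1.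
Proof. by case: (clampP x) => -[? ->]; lra. Qed.

Lemma clamp_id x : 0 <= x <= 1 -> clamp x = x.
Proof. by case: (clampP x) => -[? ->]; lra. Qed.

Lemma clamp_continuous : continuous clamp.
Proof.
move=> x; apply: (@continuous_max R R (cst 0) (Num.min 1)).
  exact: cvg_cst.
by apply: (@continuous_min R R (cst 1) id); [exact: cvg_cst|exact: cvg_id].
Qed.

(** Vanishing outside the open unit interval is the natural form of [p 0 = 0]
    and [p 1 = 0] here: translates of such functions by integers can be added. *)
Record loop := Loop { loop_fun :> R -> R;
  loop_continuous : continuous loop_fun;
  loop_itv : forall t, 0 <= loop_fun t <= 1;
  loop_out : forall t, ~~ (0 < t < 1) -> loop_fun t = 0 }.

End Loops.

Section Routes.
Variables (R : realType) (K : choiceType) (Y : topologicalType).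
Variables (f : K -> Y -> R).
Hypotheses (fcont : forall k, continuous (f k)) (f01 : forall k y, 0 <= f k y <= 1).
Hypothesis connY : connected [set: Y].
Variables (s : seq K) (e : R).
Hypothesis e0 : 0 < e.

Definition near_image (g : K -> R) :=
  exists w, forall k, k \in s -> `|g k - f k w| < e.

(** The points of [ys] are met exactly and in all coordinates, whereas the path
    is only asked to stay close to the image of [Y] in the coordinates of [s]:
    in general the latter condition cannot be met in all coordinates at once. *)
Definition route (ys : seq Y) (a b : Y) := exists g : R -> K -> R,
  [/\ forall k, continuous (g^~ k), g 0 = f^~ a, g 1 = f^~ b,
      forall t, near_image (g t) /\ forall k, 0 <= g t k <= 1 &
      forall y, y \in ys -> exists2 t : R, 0 <= t <= 1 & g t = f^~ y].

Lemma route_cat ys zs a b c :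
  route ys a b -> route zs b c -> route (ys ++ zs) a c.
Proof.
move=> [g [gc g0 g1 gs gys]] [h [hc h0 h1 hs hzs]].
pose l (t : R) := clamp (2 * t); pose r (t : R) := clamp (2 * t - 1).
(* Both halves are reparametrized and frozen at the common point outside their
   half, so that their sum minus that point is continuous without gluing. *)
pose q (t : R) (k : K) := g (l t) k + h (r t) k - f k b.
have ql t : t <= 2^-1 -> q t = g (l t).
  move=> t2; apply/funext => k; rewrite /q.
  have -> : r t = 0 by rewrite /r; case: (clampP (2 * t - 1)) => -[? ->]; lra.
  by rewrite h0 addrK.
have qr t : 2^-1 <= t -> q t = h (r t).
  move=> t2; apply/funext => k; rewrite /q.
  have -> : l t = 1 by rewrite /l; case: (clampP (2 * t)) => -[? ->]; lra.
  by rewrite g1 addrC addKr.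
have lc : continuous l.
  move=> t; apply: (@continuous_comp _ _ _ (fun t : R => 2 * t) (@clamp R)).
    exact: mulrl_continuous.
  exact: clamp_continuous.
have rc : continuous r.
  move=> t; apply: (@continuous_comp _ _ _ (fun t : R => 2 * t - 1) (@clamp R)).
    by apply: cvgB; [apply: mulrl_continuous|exact: cvg_cst].
  exact: clamp_continuous.
exists q; split.
- move=> k t; apply: cvgB; last exact: cvg_cst.
  apply: cvgD.
    by apply: (@continuous_comp _ _ _ l (g^~ k)); [exact: lc|exact: gc].
  by apply: (@continuous_comp _ _ _ r (h^~ k)); [exact: rc|exact: hc].
- by rewrite ql// ?invr_ge0// /l mulr0 clamp_id// lexx ler01.
- rewrite qr; last lra.
  by rewrite /r clamp_id; [rewrite (_ : 2 * 1 - 1 = 1 :> R)//; lra|lra].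
- move=> t; have [t2|/ltW t2] := leP t 2^-1; first by rewrite ql.
  by rewrite qr.
- move=> y; rewrite mem_cat => /orP[/gys[t t01 gt]|/hzs[t t01 ht]].
    exists (t / 2); first lra.
    by rewrite ql; [rewrite /l clamp_id (_ : 2 * (t / 2) = t)//; lra|lra].
  exists ((t + 1) / 2); first lra.
  by rewrite qr; [rewrite /r clamp_id (_ : 2 * ((t + 1) / 2) - 1 = t)//; lra|lra].
Qed.

Lemma route_point a : route [:: a] a a.
Proof.
exists (fun _ => f^~ a); split=> //.
- by move=> k t; exact: cvg_cst.
- by move=> t; split=> //; exists a => k _; rewrite subrr normr0.
- by move=> y; rewrite inE => /eqP->; exists 0; rewrite ?lexx ?ler01.
Qed.

Lemma route_segment a b : (forall k, k \in s -> `|f k a - f k b| < e) ->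
  route [::] a b.
Proof.
move=> ab.
exists (fun t k => f k a + clamp t * (f k b - f k a)); split=> //.
- move=> k t; apply: cvgD; first exact: cvg_cst.
  apply: cvgM; last exact: cvg_cst.
  exact: clamp_continuous.
- by apply/funext => k; rewrite clamp_id ?mul0r ?addr0// lexx ler01.
- by apply/funext => k; rewrite clamp_id ?mul1r ?lexx ?ler01//; lra.
- move=> t; split=> [|k]; last first.
    by have := clamp_itv t; have := f01 k a; have := f01 k b; nra.
  exists a => k /ab; rewrite addrAC subrr add0r normrM distrC.
  apply: le_lt_trans; have /andP[c0 c1] := clamp_itv t.
  by rewrite ger0_norm// ler_piMl.
Qed.

Lemma near_all a : \forall b \near a, forall k, k \in s -> `|f k a - f k b| < e.
Proof.
elim: s => [|k r IH]; first exact: nearW.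
have : \forall b \near a, `|f k a - f k b| < e.
  by have /cvgrPdist_lt := @fcont k a; exact.
by apply: filterS2 IH => b + bk j; rewrite inE => /[swap] /predU1P[->//|/[swap]]; exact.
Qed.

(** The points reachable from [a] form a set that is open, as is its
    complement, because nearby points are joined by segments. *)
Lemma route_connect a b : route [::] a b.
Proof.
have rev c d : (forall k, k \in s -> `|f k c - f k d| < e) ->
    forall k, k \in s -> `|f k d - f k c| < e.
  by move=> cd k /cd; rewrite distrC.
suff reachE : [set b | route [::] a b] = [set: Y].
  by have : [set: Y] b by []; rewrite -reachE.
apply: connY.
- by exists a => /=; apply: route_segment => k _; rewrite subrr normr0.
- exists [set b | route [::] a b]; last by rewrite setTI.
  rewrite openE => c ac; apply: filterS (near_all c) => d /route_segment.
  exact: (route_cat ac).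
- exists [set b | route [::] a b]; last by rewrite setTI.
  rewrite -[X in closed X]setCK; apply: open_closedC; rewrite openE => c nac.
  apply: filterS (near_all c) => d /rev /route_segment dc ad; apply: nac.
  exact: (route_cat ad dc).
Qed.

Lemma route_tour ys a : route ys a a.
Proof.
elim: ys => [|y ys IH]; first exact: route_connect.
have := route_cat (route_connect a y) (route_point y).
by move=> /route_cat /(_ (route_connect y a)) /route_cat /(_ IH).
Qed.

(** However intricate the continuum, the neighbourhoods of its image in
    finitely many coordinates contain loops through any finitely many of its
    points. *)
Lemma loops_through (ys : seq Y) y0 : (forall k, f k y0 = 0) ->
  exists p : K -> loop R, (forall t, near_image (fun k => p k t)) /\
    forall y, y \in ys -> exists2 t : R, 0 <= t <= 1 & forall k, p k t = f k y.
Proof.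
move=> fy0; have [g [gc g0 g1 gs gys]] := route_tour ys y0.
have out k t : ~~ (0 < t < 1) -> g (clamp t) k = 0.
  move=> tN; have [->|->] : clamp t = 0 \/ clamp t = 1.
  - case: (clampP t) => -[t01 tE]; rewrite tE; [by left| |by right].
    have [?|?] := leP t 0; [left|right]; lra.
  - by rewrite g0.
  - by rewrite g1.
have cc k : continuous (fun t => g (clamp t) k).
  move=> t; apply: (@continuous_comp _ _ _ (@clamp R) (g^~ k)).
    exact: clamp_continuous.
  exact: gc.
exists (fun k => Loop (cc k) (fun t => (gs (clamp t)).2 k) (out k)).
split=> [t|y /gys[t t01 gt]]; first exact: (gs (clamp t)).1.
by exists t => //= k; rewrite clamp_id// gt.
Qed.

End Routes.

(** * The cube and its rational boxes *)

Lemma rat_approx (R : realType) (x e : R) : 0 < e ->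
  exists a b : rat, ratr a < x < ratr b /\ (x - e < ratr a) && (ratr b < x + e).
Proof.
move=> e0.
have [a] : exists a : rat, ratr a \in `]x - e, x[ by apply: rat_in_itvoo; lra.
have [b] : exists b : rat, ratr b \in `]x, x + e[ by apply: rat_in_itvoo; lra.
rewrite !in_itv /= => /andP[? ?] /andP[? ?].
by exists a, b; split; apply/andP; split.
Qed.

Lemma cluster_limit (R : realType) (T : topologicalType) (F : set_system T)
    (phi : T -> R) x c :
  continuous phi -> cluster F x -> phi @ F --> c -> phi x = c.
Proof.
move=> phic clx Fc; apply/esym/(@Rhausdorff R) => U V Uc Vx.
by have [y [Uy Vy]] := clx _ _ (Fc _ Uc) (phic _ _ Vx); exists (phi y).
Qed.

Section SubspaceType.
Variables (X : topologicalType) (A : set X).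

Lemma set_type_hausdorff : hausdorff_space X -> hausdorff_space (set_type A).
Proof.
move=> hX x y xy; apply/val_inj/hX => U V Ux Vy.
have [z [Uz Vz]] := xy _ _ (@initial_continuous _ _ set_val x _ Ux)
  (@initial_continuous _ _ set_val y _ Vy).
by exists (set_val z).
Qed.

Lemma set_type_compact : compact A -> compact [set: set_type A].
Proof.
move=> cA F FF _.
have [|x [Ax clx]] := cA (set_val @ F).
  by apply: (@filterS _ F _ setT) => [x _|]; [exact: set_valP|exact: filterT].
exists (exist _ x (mem_set Ax)); split=> // U V FU [_ [[W oW <-] Wx WV]].
have [] := clx (set_val @` U) W.
- by apply: (@filterS _ F _ U) => // y Uy; exists y.
- by apply: open_nbhs_nbhs; split.
- by move=> _ [[y Uy <-] Wy]; exists y; split=> //; exact: WV.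
Qed.

Lemma set_type_cvg T (F : set_system T) (g : T -> set_type A) (x : set_type A) :
  Filter F -> set_val \o g @ F --> set_val x -> g @ F --> x.
Proof.
move=> FF gx U [_ [[W oW <-] Wx WU]].
by apply: (filterS WU); apply: gx; apply: open_nbhs_nbhs; split.
Qed.

End SubspaceType.

Section Cube.
Variables (R : realType) (X : topologicalType).
Local Notation I := (unit_interval R).
Local Notation C := (continuousType X I).
Local Notation cube := (cube R X).

Lemma unit_interval_compact : compact [set: I].
Proof. exact/set_type_compact/segment_compact. Qed.

Lemma cube_compact : compact [set: cube].
Proof.
have := @tychonoff C (fun=> I) (fun=> setT) (fun=> unit_interval_compact).
by congr compact; apply/seteqP; split.
Qed.

Lemma cube_hausdorff : hausdorff_space cube.
Proof.
exact: (@hausdorff_product C (fun=> I) (fun=> set_type_hausdorff (@Rhausdorff R))).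
Qed.

Definition cube_coord (f : C) (z : cube) : R := set_val (z f).

Lemma coord_continuous f : continuous (cube_coord f).
Proof.
move=> z; apply: (@continuous_comp _ _ _ (fun z : cube => z f) set_val).
  exact: (@proj_continuous C (fun=> I) f z).
exact: initial_continuous.
Qed.

(** The neighbourhoods in the cube are handled through this characterization of
    convergence, for instance by comparison with the filter of boxes. *)
Lemma cube_cvg (F : set_system cube) (z : cube) : Filter F ->
  (forall f, cube_coord f @ F --> cube_coord f z) -> F --> z.
Proof.
move=> FF Fz; apply/cvg_sup => f U [_ [[_ [W oW <-] <-] Wz WU]].
by apply: filterS WU _; apply: Fz; apply: open_nbhs_nbhs; split.
Qed.

Lemma evaluation_continuous : continuous (@evaluation R X).
Proof.
move=> x; apply: cube_cvg => f.
rewrite /fmap /=.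
apply: (@continuous_comp _ _ _ f set_val); first exact: cts_fun.
exact: initial_continuous.
Qed.

Definition box (s : seq (C * (rat * rat))) : set cube :=
  [set z | forall c, c \in s -> ratr c.2.1 < cube_coord c.1 z < ratr c.2.2].

Lemma box_open s : open (box s).
Proof.
elim: s => [|[f [a b]] s IH].
  by rewrite (_ : box [::] = setT); [exact: openT|apply/seteqP; split].
rewrite (_ : box _ = cube_coord f @^-1` `]ratr a, ratr b[ `&` box s); last first.
  apply/seteqP; split=> [z zb|z [zab zs] c].
    split; first by rewrite /= in_itv /=; apply: (zb (f, (a, b))); rewrite mem_head.
    by move=> c cs; apply: zb; rewrite inE cs orbT.
  by rewrite inE => /predU1P[->|/zs//]; move: zab; rewrite /= in_itv.
apply: openI IH; apply: open_comp; last exact: itv_open.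
by move=> z _; exact: coord_continuous.
Qed.

Lemma box_nbhs (z : cube) U : nbhs z U -> exists2 s, box s z & box s `<=` U.
Proof.
pose F := filter_from [set s | box s z] box.
have FF : Filter F.
  apply: filter_from_filter; first by exists [::].
  move=> s t sz tz; exists (s ++ t).
    by move=> c; rewrite mem_cat => /orP[/sz|/tz].
  by move=> w wst; split=> c cs; apply: wst; rewrite mem_cat cs ?orbT.
suff Fz : F --> z by move=> /Fz[s sz sU]; exists s.
apply: cube_cvg => f; apply/cvgrPdist_lt => e e0.
have [a [b [/andP[az zb] /andP[ea be]]]] := rat_approx (cube_coord f z) e0.
exists [:: (f, (a, b))]; first by move=> c; rewrite inE => /eqP-> /=; rewrite az.
move=> w /(_ (f, (a, b)) (mem_head _ _)) /= /andP[aw wb].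
by rewrite ltr_norml; apply/andP; split; lra.
Qed.

End Cube.

(** * The half line in the cube *)

Section Remainder.
Variable R : realType.
Local Notation H := (half_line R).
Local Notation I := (unit_interval R).
Local Notation C := (continuousType H I).
Local Notation cube := (cube R H).
Local Notation Hstar := (half_line_remainder R).

Lemma half_line_max t : `[0 : R, +oo[%classic (Num.max 0 t).
Proof. by rewrite /= in_itv /= andbT le_max lexx. Qed.

Definition to_half_line (t : R) : H :=
  exist (fun x => x \in _) _ (mem_set (half_line_max t)).

Lemma to_half_line_continuous : continuous to_half_line.
Proof.
move=> t; apply: set_type_cvg.
by apply: (@continuous_max R R (cst 0) id); [exact: cvg_cst|exact: cvg_id].
Qed.

Lemma set_val_half_lineK (x : H) : to_half_line (set_val x) = x.
Proof.
apply: val_inj => /=; apply/max_r.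
by have := set_valP x; rewrite /= in_itv /= andbT.
Qed.

Lemma unit_interval_clamp t : `[0 : R, 1]%classic (clamp t).
Proof. by rewrite /= in_itv /= clamp_itv. Qed.

Definition to_unit (t : R) : I :=
  exist (fun x => x \in _) _ (mem_set (unit_interval_clamp t)).

Lemma to_unit_continuous : continuous to_unit.
Proof. by move=> t; apply: set_type_cvg; exact: clamp_continuous. Qed.

Lemma clamped_continuous (g : R -> R) : continuous g ->
  continuous (fun x : H => to_unit (g (set_val x))).
Proof.
move=> gc x; apply: (@continuous_comp _ _ _ (fun x : H => g (set_val x)) to_unit).
  apply: (@continuous_comp _ _ _ set_val g); first exact: initial_continuous.
  exact: gc.
exact: to_unit_continuous.
Qed.

(** Functions of a real variable clamped to the unit interval provide all the
    functions on the half line that are needed explicitly. *)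
Definition clamped (g : R -> R) (gc : continuous g) : C :=
  mkcts (clamped_continuous gc).

(** The half line inside the cube, parametrized by all reals (constantly on the
    negative ones) so as to reason about real functions and intervals. *)
Definition ray (t : R) : cube := @evaluation R H (to_half_line t).

Lemma ray_continuous : continuous ray.
Proof.
move=> t; apply: (@continuous_comp _ _ _ to_half_line (@evaluation R H)).
  exact: to_half_line_continuous.
exact: evaluation_continuous.
Qed.

Lemma coord_clamped g (gc : continuous g) t : 0 <= t ->
  cube_coord (clamped gc) (ray t) = clamp (g t).
Proof.
move=> t0; rewrite /cube_coord /ray /= /evaluation /join_product /= /mkcts.
by rewrite set_valE /= set_valE /= max_r.
Qed.

Definition ray_from (n : nat) : set cube := ray @` `[n%:R, +oo[.

(** A point of the closure of the half line outside the half line is a limit of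
    points going to infinity, since the initial segments are compact, hence
    closed. Conversely, the function that is [0] at [x] and [1] beyond [x + 1]
    keeps the tails away from the point [x]. *)
Lemma remainderP (z : cube) :
  (@stone_cech R H `\` range (@evaluation R H)) z <-> forall n, closure (ray_from n) z.
Proof.
split=> [[clz Nz] n|clz].
  have rangeE : range (@evaluation R H) `<=` ray @` `[0, n%:R] `|` ray_from n.
    move=> _ [x _ <-]; have := set_valP x; rewrite /= in_itv /= andbT => x0.
    have rx : ray (set_val x) = @evaluation R H x by rewrite /ray set_val_half_lineK.
    have [xn|nx] := leP (set_val x) n%:R; [left|right]; exists (set_val x) => //=.
      by rewrite in_itv /= x0.
    by rewrite in_itv /= andbT ltW.
  have := closureS rangeE clz; rewrite closureU => -[|//].
  have /closure_id <- : closed (ray @` `[0, n%:R]).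
    apply: compact_closed; first exact: cube_hausdorff.
    apply: continuous_compact; last exact: segment_compact.
    exact/continuous_subspaceT/ray_continuous.
  by move=> [t _ tz]; case: Nz; exists (to_half_line t).
split.
  by apply: closureS (clz 0%N) => _ [t _ <-]; exists (to_half_line t).
move=> [x _ xz].
pose u := set_val x.
have gc : continuous (fun t : R => t - u).
  by move=> t; apply: cvgB; [exact: cvg_id|exact: cvg_cst].
have u0 : 0 <= u by have := set_valP x; rewrite /= in_itv /= andbT.
have z0 : cube_coord (clamped gc) z = 0.
  by rewrite -xz -(set_val_half_lineK x) coord_clamped// subrr clamp_id// lexx ler01.
have : nbhs z (cube_coord (clamped gc) @^-1` `]-oo, 1[).
  apply: coord_continuous; rewrite z0; apply: open_nbhs_nbhs; split.
    exact: lray_open.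
  by rewrite /= in_itv /= ltr01.
move=> /(clz (Num.truncn u).+2) [_ [[t + <-]]]; rewrite /= !in_itv /= andbT => tu.
move: tu; rewrite -natr1 => tu; have ut := truncnS_gt u.
have t0 : 0 <= t by lra.
by rewrite (coord_clamped gc t0); case: (clampP (t - u)) => -[? ->]; lra.
Qed.

End Remainder.

(** * The remainder is a continuum *)

Section RemainderContinuum.
Variable R : realType.
Local Notation H := (half_line R).
Local Notation cube := (cube R H).
Local Notation Hstar := (half_line_remainder R).

Lemma remainder_witness (z : Hstar) (U : set cube) (n : nat) :
  nbhs (set_val z) U -> exists2 t : R, n%:R <= t & U (ray t).
Proof.
have /remainderP/(_ n) clz := set_valP z.
move=> /clz[_ [[t + <-] Ut]]; rewrite /= in_itv /= andbT => nt.
by exists t.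
Qed.

(** The source of points of the remainder: any filter going to infinity has a
    cluster point, by compactness of the cube. *)
Lemma remainder_cluster (F : set_system R) : ProperFilter F ->
  (forall n : nat, F `[n%:R, +oo[%classic) ->
  exists z : Hstar, cluster (@ray R @ F) (set_val z).
Proof.
move=> FF Foo.
have [|z [_ clz]] := @cube_compact R H (@ray R @ F) _; first exact: filterT.
have rz : (@stone_cech R H `\` range (@evaluation R H)) z.
  apply/remainderP => n U; apply: clz.
  have : F (@ray R @^-1` @ray_from R n) by apply: filterS (Foo n) => t nt; exists t.
  by [].
by exists (exist _ z (mem_set rz)).
Qed.

Lemma remainder_nonempty : [set: Hstar] !=set0.
Proof.
have [n|z _] := @remainder_cluster (pinfty_nbhs R) _; last by exists z.
by exists n%:R; split=> [|t /ltW nt]; rewrite ?num_real//= in_itv /= andbT.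
Qed.

Lemma remainder_hausdorff : hausdorff_space Hstar.
Proof. exact/set_type_hausdorff/cube_hausdorff. Qed.

Lemma remainder_compact : compact [set: Hstar].
Proof.
apply: set_type_compact.
have -> : @stone_cech R H `\` range (@evaluation R H) =
    \bigcap_n closure (@ray_from R n).
  apply/seteqP; split=> z; first by move=> /remainderP rz n _; exact: rz.
  by move=> rz; apply/remainderP => n; exact: rz.
apply: (@subclosed_compact _ _ setT); last by [].
  by apply: closed_bigI => n _; exact: closed_closure.
exact: cube_compact.
Qed.

(** A decreasing intersection of continua is connected. Disjoint open
    neighbourhoods of two complementary clopen parts cover a tail of the half
    line, for otherwise the points outside them would cluster at a point of the
    remainder outside both parts; but that tail is connected and meets both. *)
Lemma remainder_connected : connected [set: Hstar].
Proof.
move=> B [b Bb] [O oO BO] [D cD BD].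
have imclosed (E : set Hstar) : closed E -> closed (set_val @` E).
  move=> cE; apply: compact_closed; first exact: cube_hausdorff.
  apply: continuous_compact; first exact/continuous_subspaceT/initial_continuous.
  exact: subclosed_compact remainder_compact _.
have cB : closed B by rewrite BD setTI.
have cB' : closed (~` B) by apply: open_closedC; rewrite BO setTI.
have [|U [V [oU oV BU BV UV]]] :=
  (@normal_openP R _).1 (compact_normal (@cube_hausdorff R H) (@cube_compact R H))
  _ _ (imclosed _ cB) (imclosed _ cB').
  by apply/seteqP; split => // _ [[x Bx <-] [y By /val_inj yx]]; rewrite yx in By.
have [n rayUV] : exists n, @ray_from R n `<=` U `|` V.
  apply: contrapT => /forallNP nUV.
  pose F := filter_from [set: nat] (fun n =>
    `[n%:R, +oo[%classic `\` (@ray R @^-1` (U `|` V))).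
  have FF : ProperFilter F.
    apply: filter_from_proper => [|n _]; last first.
      have /existsNP[_ /not_implyP[[t nt <-] rt]] := nUV n.
      by exists t.
    apply: filter_fromT_filter; first by exists 0%N.
    move=> i j; exists (maxn i j) => t [/=]; rewrite !in_itv /= !andbT natr_max.
    rewrite ge_max => /andP[it jt] UVt.
    by split; split; rewrite //= ?in_itv /= ?andbT.
  have [|z clz] := remainder_cluster FF.
    by move=> n; exists n => // t [].
  have : nbhs (set_val z) (U `|` V).
    apply: open_nbhs_nbhs; split; first exact: openU.
    by have [Bz|Bz] := pselect (B z); [left; apply: BU|right; apply: BV]; exists z.
  have /clz : (@ray R @ F) (~` (U `|` V)) by exists 0%N => // t [].
  by move=> /[apply] -[w []].
have conn : connected (@ray_from R n).
  apply: connected_continuous_connected.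
    exact/connected_intervalP/interval_is_interval.
  exact/continuous_subspaceT/ray_continuous.
have meet (x : Hstar) (W : set cube) : open W -> W (set_val x) ->
    exists t, ray_from n (ray t) /\ W (ray t).
  move=> oW Wx; have [|t nt Wt] := @remainder_witness x W n.
    exact: open_nbhs_nbhs.
  by exists t; split => //; exists t => //; rewrite /= in_itv /= andbT.
have raynU : @ray_from R n `&` U = @ray_from R n.
  apply: conn.
  - have [|t [? ?]] := meet b U oU; first by apply: BU; exists b.
    by exists (ray t).
  - by exists U.
  - exists (~` V); first exact: open_closedC.
    apply/seteqP; split => x [nx].
      move=> Ux; split=> // Vx; suff : (U `&` V) x by rewrite UV.
      by [].
    by move=> nV; split=> //; have [] := rayUV _ nx.
apply/seteqP; split=> // x _; apply: contrapT => Bx.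
have [|t [nt Vt]] := meet x V oV; first by apply: BV; exists x.
have [_ Ut] : (@ray_from R n `&` U) (ray t) by rewrite raynU.
suff : (U `&` V) (ray t) by rewrite UV.
by [].
Qed.

Lemma remainder_continuum : continuum Hstar.
Proof.
split.
- exact: remainder_nonempty.
- exact: remainder_compact.
- exact: remainder_connected.
- exact: remainder_hausdorff.
Qed.

End RemainderContinuum.

(** * Concatenation of loops *)

Section Concatenation.
Variable R : realType.

Definition concat (p : nat -> loop R) (x : R) : R :=
  p (Num.truncn x) (x - (Num.truncn x)%:R).

Lemma concatE p n t : 0 <= t <= 1 -> concat p (n%:R + t) = p n t.
Proof.
move=> /andP[t0]; rewrite le_eqVlt /concat => /predU1P[->|t1].
  by rewrite natr1 natrK subrr !loop_out// ?ltxx ?andbF.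
have -> : Num.truncn (n%:R + t) = n.
  by apply: truncn_def; rewrite -[n.+1%:R]natr1; apply/andP; split; lra.
by rewrite addrAC subrr add0r.
Qed.

(** Below any bound the concatenation is a finite sum of translates of loops,
    which makes its continuity obvious, also at the integers. *)
Lemma concat_sum p N x : x < N%:R ->
  concat p x = \sum_(i < N) p i (x - i%:R).
Proof.
move=> xN; have [x0|x0] := ltP x 0.
  rewrite /concat big1 => [|i _]; rewrite loop_out//.
    by have := ler0n R (Num.truncn x); lra.
  by have := ler0n R i; lra.
have /andP[tx xt] := truncn_itv x0.
have tN : (Num.truncn x < N)%N by rewrite truncn_lt_nat.
rewrite (bigD1 (Ordinal tN)) //= big1 ?addr0// => i ineq.
rewrite loop_out//; apply/negP => /andP[i0 i1].
move/eqP: ineq; apply; apply/val_inj => /=; symmetry; apply: truncn_def.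
by rewrite -[i.+1%:R]natr1; apply/andP; split; lra.
Qed.

Lemma concat_continuous p : continuous (concat p).
Proof.
move=> x; have [N xN] : exists N : nat, x < N%:R.
  by exists (Num.truncn x).+1; exact: truncnS_gt.
have /(_ x) sumc : continuous (fun y : R => \sum_(i < N) p i (y - i%:R) : R).
  elim: N {xN} => [|N IH] y.
    by under eq_fun do rewrite big_ord0; exact: cvg_cst.
  under eq_fun do rewrite big_ord_recr /=.
  apply: cvgD; first exact: IH.
  apply: (@continuous_comp _ _ _ (fun y : R => y - N%:R) (p N)).
    by apply: cvgB; [exact: cvg_id|exact: cvg_cst].
  exact: loop_continuous.
rewrite /continuous_at (concat_sum p xN); apply: cvg_trans sumc.
apply: near_eq_cvg; near=> y; rewrite -concat_sum//.
near: y; exact: lt_nbhsl.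
Unshelve. all: by end_near. Qed.

Definition coord_concat p := clamped (@concat_continuous p).

Lemma coord_concatE p n t : 0 <= t <= 1 ->
  cube_coord (coord_concat p) (ray (n%:R + t)) = p n t.
Proof.
move=> t01; rewrite coord_clamped; first by rewrite clamp_id concatE// loop_itv.
by have := ler0n R n; lra.
Qed.

End Concatenation.

(** * The weight of the remainder *)

Section AlmostDisjoint.

(** The codes of the finite initial segments of [x]: the branches of the binary
    tree are an almost disjoint family of continuum many infinite sets. *)
Definition prefixes (x : set nat) : set nat :=
  [set n | exists k, n = pickle (mkseq (fun i => `[< x i >]) k)].

Lemma prefixes_unbounded x N : exists2 n, prefixes x n & (N <= n)%N.
Proof.
pose c k := pickle (mkseq (fun i => `[< x i >]) k).
have cinj : injective c.
  by move=> k l /(pcan_inj pickleK)/(congr1 size); rewrite !size_mkseq.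
have [k Nk] : exists k, (N <= c k)%N.
  case: N => [|N]; first by exists 0%N.
  exact: injective_gtn cinj N.
by exists (c k) => //; exists k.
Qed.

Lemma prefixes_almost_disjoint x y : x <> y ->
  exists N, forall n, prefixes x n -> prefixes y n -> (n < N)%N.
Proof.
move=> xy; have [i xyi] : exists i, `[< x i >] <> `[< y i >].
  apply: contrapT => /forallNP xyE; apply: xy; apply/funext => i.
  have /contrapT xyi := xyE i.
  by apply/propext; split=> /asboolP; [rewrite xyi|rewrite -xyi] => /asboolP.
pose c k := pickle (mkseq (fun i => `[< x i >]) k).
exists (\sum_(k < i.+1) c k).+1 => _ [k ->] [l] /(pcan_inj pickleK) kl.
have lk : l = k by move/(congr1 size): kl; rewrite !size_mkseq.
rewrite ltnS -/(c k); have [ki|ik] := leqP k i.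
  have ki' : (k < i.+1)%N by [].
  by rewrite (bigD1 (Ordinal ki')) //= leq_addr.
by case: xyi; move/(congr1 (fun s => nth false s i)): kl; rewrite lk !nth_mkseq.
Qed.

End AlmostDisjoint.

Section Encoding.

Definition encode T (item : T -> set nat) (s : seq T) : set nat :=
  [set m | exists i n x, [/\ onth s i = Some x, item x n & m = pickle (i, n)]].

Lemma encode_inj T (item : T -> set nat) : (forall x, item x !=set0) ->
  injective item -> injective (encode item).
Proof.
move=> item0 item_inj.
have sub s t i x : encode item s = encode item t -> onth s i = Some x ->
    exists2 y, onth t i = Some y & item x `<=` item y.
  move=> st ix; have [n xn] := item0 x.
  have : encode item s (pickle (i, n)) by exists i, n, x.
  rewrite st => -[j [m [y [jy ym /(pcan_inj pickleK)[ij nm]]]]].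
  exists y => [|k xk]; first by rewrite ij.
  have : encode item s (pickle (i, k)) by exists i, k, x.
  rewrite st => -[j' [m' [y' [jy' ym' /(pcan_inj pickleK)[ij' nm']]]]].
  by move: jy'; rewrite -ij' ij jy => -[->]; rewrite nm'.
move=> s t st; apply: eq_from_onth => i.
case ix: (onth s i) => [x|]; last first.
  by case iy: (onth t i) => [y|//]; have [x] := sub _ _ _ _ (esym st) iy; rewrite ix.
have [y iy xy] := sub _ _ _ _ st ix.
have [z iz yz] := sub _ _ _ _ (esym st) iy.
rewrite iy; congr Some; apply: item_inj; apply/seteqP; split=> //.
by move: iz; rewrite ix => -[->].
Qed.

End Encoding.

Section Weight.
Variable R : realType.
Local Notation H := (half_line R).
Local Notation C := (continuousType H (unit_interval R)).
Local Notation cube := (cube R H).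
Local Notation Hstar := (half_line_remainder R).
Local Open Scope card_scope.

Lemma tent_continuous : continuous (fun t : R => clamp (1 - `|2 * t - 1|)).
Proof.
move=> t; apply: (@continuous_comp _ _ _ (fun t : R => 1 - `|2 * t - 1|) (@clamp R)).
  apply: cvgB; first exact: cvg_cst.
  apply: (@continuous_comp _ _ _ (fun t : R => 2 * t - 1) Num.norm).
    by apply: cvgB; [exact: mulrl_continuous|exact: cvg_cst].
  exact: norm_continuous.
exact: clamp_continuous.
Qed.

Lemma tent_out t : ~~ (0 < t < 1) -> clamp (1 - `|2 * t - 1|) = 0 :> R.
Proof.
rewrite negb_and -!leNgt => t01.
have : 1 <= `|2 * t - 1|.
  case/orP: t01 => t01; last by have := ler_norm (2 * t - 1); lra.
  by have := ler_norm (- (2 * t - 1)); rewrite normrN; lra.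
by case: (clampP (1 - `|2 * t - 1|)) => -[? ->]; lra.
Qed.

Definition tent : loop R :=
  Loop tent_continuous (fun t => clamp_itv _) tent_out.

Definition flat : loop R :=
  @Loop R (cst 0) (fun t => cvg_cst _) (fun=> ltac:(by rewrite lexx ler01))
    (fun _ _ => erefl).

Definition bumps (A : set nat) : C :=
  coord_concat (fun n => if `[< A n >] then tent else flat).

Definition bump_region (x : set nat) : set Hstar :=
  set_val @^-1` (cube_coord (bumps (prefixes x)) @^-1` `]2^-1, +oo[).

Lemma bump_region_open x : open (bump_region x).
Proof.
apply: open_comp; first by move=> z _; exact: initial_continuous.
apply: open_comp; first by move=> z _; exact: coord_continuous.
exact: rray_open.
Qed.

Lemma bump_region_neq0 x : bump_region x !=set0.
Proof.
pose F := filter_from [set: nat] (fun N : nat =>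
  [set t : R | exists2 n, (N <= n)%N & prefixes x n /\ t = n%:R + 2^-1]).
have FF : ProperFilter F.
  apply: filter_from_proper => [|N _]; last first.
    have [n xn Nn] := prefixes_unbounded x N.
    by exists (n%:R + 2^-1); exists n.
  apply: filter_fromT_filter; first by exists 0%N.
  move=> i j; exists (maxn i j) => t [n]; rewrite geq_max => /andP[ni nj] tn.
  by split; exists n.
have half01 : 0 <= (2^-1 : R) <= 1 by apply/andP; split; lra.
have [|z clz] := remainder_cluster FF.
  move=> N; exists N => // t [n Nn [_ ->]]; rewrite /= in_itv /= andbT.
  have : (N%:R : R) <= n%:R by rewrite ler_nat.
  lra.
exists z; suff : cube_coord (bumps (prefixes x)) (set_val z) = 1.
  by rewrite /bump_region /= in_itv /= andbT => ->; lra.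
apply: (cluster_limit (@coord_continuous R H _) clz).
apply: (@cvg_near_cst _ _ _ _ F) => //.
exists 0%N => // t [n _ [xn ->]] /=; rewrite /bumps coord_concatE//.
case: asboolP => // _.
rewrite -[LHS]/(clamp (1 - `|2 * 2^-1 - 1|)) (_ : 2 * 2^-1 - 1 = 0 :> R); last by lra.
by rewrite normr0 subr0 clamp_id// lexx ler01.
Qed.

(** Only finitely many bumps are common to the two functions, so that they
    cannot both be large near infinity. *)
Lemma bump_region_disjoint x y : bump_region x `&` bump_region y !=set0 -> x = y.
Proof.
move=> [z [xz yz]]; apply: contrapT => /prefixes_almost_disjoint[N xyN].
pose U := cube_coord (bumps (prefixes x)) @^-1` `]2^-1, +oo[ `&`
  cube_coord (bumps (prefixes y)) @^-1` `]2^-1, +oo[.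
have [|t Nt [xt yt]] := @remainder_witness R z U N.
  apply: open_nbhs_nbhs; split=> //; apply: openI;
    apply: open_comp => [w _|]; by [exact: coord_continuous|exact: rray_open].
have t0 : 0 <= t by apply: le_trans Nt.
have pos (A : set nat) :
    (cube_coord (bumps A) @^-1` `]2^-1, +oo[) (ray t) -> A (Num.truncn t).
  rewrite /= in_itv /= andbT coord_clamped// clamp_id ?loop_itv// /concat.
  by case: asboolP => //= _; rewrite ltNge invr_ge0 ler0n.
have := xyN _ (pos _ xt) (pos _ yt).
by rewrite ltnNge truncn_ge_nat// Nt.
Qed.

(** A basis has a nonempty member inside each of the disjoint open sets
    [bump_region x]. *)
Lemma continuum_le_basis (B : set (set Hstar)) : basis B -> continuum_card #<= B.
Proof.
move=> [Bop Bbase].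
have /choice[g gP] : forall x, exists W, [/\ B W, W !=set0 & W `<=` bump_region x].
  move=> x; have [z xz] := bump_region_neq0 x.
  have [W [BW Wz] WU] := Bbase z _ (open_nbhs_nbhs (conj (bump_region_open x) xz)).
  by exists W; split => //; exists z.
apply/pcard_leP/injfunPex; exists g => [x _|x y _ _ gxy].
  by have [] := gP x.
have [_ [z xz] xU] := gP x; have [_ _ yU] := gP y.
by apply: bump_region_disjoint; exists z; split; [exact: xU|apply: yU; rewrite -gxy].
Qed.

(** The rational points of the region under the graph of [f]; by density they
    determine [f]. *)
Definition undergraph (f : C) : set nat :=
  [set n | exists q r : rat, ratr r < cube_coord f (ray (ratr q)) /\ n = pickle (q, r)].

Lemma coord_ray_continuous (f : C) : continuous (fun t : R => cube_coord f (ray t) : R).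
Proof.
move=> t; apply: (@continuous_comp _ _ _ (@ray R) (cube_coord f)).
  exact: ray_continuous.
exact: coord_continuous.
Qed.

Lemma undergraph_inj : injective undergraph.
Proof.
move=> f g fg.
have lt_undergraph (f' g' : C) t : undergraph f' = undergraph g' ->
    cube_coord f' (ray t) < cube_coord g' (ray t) -> False.
  move=> tE lt_t.
  have : \forall u \near t, cube_coord f' (ray u) < cube_coord g' (ray u).
    have dif := cvgB (@coord_ray_continuous g' t) (@coord_ray_continuous f' t).
    have pos : 0 < cube_coord g' (ray t) - cube_coord f' (ray t) by rewrite subr_gt0.
    have near_pos := cvgr_gt _ (dif (nbhs_filter t)) 0 pos.
    by near=> u; rewrite -subr_gt0; near: u; exact: near_pos.
  move=> /nbhs_ballP[e /= e0 te].
  have [q] : exists q, ratr q \in `]t - e, t + e[ by apply: rat_in_itvoo; lra.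
  rewrite in_itv /= => /andP[q1 q2].
  have qfg : cube_coord f' (ray (ratr q)) < cube_coord g' (ray (ratr q)).
    by apply: te; rewrite /ball /= ltr_distl; apply/andP; split; lra.
  have [r] := rat_in_itvoo qfg; rewrite in_itv /= => /andP[fr rg].
  have : undergraph g' (pickle (q, r)) by exists q, r.
  rewrite -tE => -[q' [r' [r'f /(pcan_inj pickleK)[qq rr]]]].
  by move: r'f; rewrite -qq -rr ltNge (ltW fr).
apply/continuousEP => x; apply: val_inj.
have rx : @evaluation R H x = ray (set_val x) by rewrite /ray set_val_half_lineK.
have coordE (h : C) : val (h x) = cube_coord h (ray (set_val x)) by rewrite -rx.
rewrite !coordE; apply/eqP; rewrite eq_le !leNgt; apply/andP; split; apply/negP.
- exact: lt_undergraph (esym fg).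
- exact: lt_undergraph fg.
Unshelve. all: by end_near. Qed.

(** A box is a finite sequence of such slabs, each confining one coordinate to a
    rational interval. *)
Definition slab_code (c : C * (rat * rat)) : set nat :=
  [set n | n = pickle (inr c.2 : nat + rat * rat) \/
    exists2 m, undergraph c.1 m & n = pickle (inl m : nat + rat * rat)].

Lemma slab_code_inj : injective slab_code.
Proof.
move=> [f a] [g b] fg.
have : slab_code (f, a) (pickle (inr a : nat + rat * rat)) by left.
rewrite fg => -[/(pcan_inj pickleK)[ab]|[m _ /(pcan_inj pickleK)//]].
have sub (f' g' : C) a' b' : slab_code (f', a') = slab_code (g', b') ->
    undergraph f' `<=` undergraph g'.
  move=> e m f'm.
  have : slab_code (f', a') (pickle (inl m : nat + rat * rat)) by right; exists m.
  by rewrite e => -[/(pcan_inj pickleK)//|[n g'n /(pcan_inj pickleK)[->]]].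
rewrite ab; congr pair; apply: undergraph_inj; apply/seteqP; split.
- exact: sub fg.
- exact: sub (esym fg).
Qed.

Definition box_basis : set (set Hstar) :=
  range (fun s : seq (C * (rat * rat)) => set_val @^-1` (box s)).

Lemma box_basisP : basis box_basis.
Proof.
split.
  move=> _ [s _ <-]; apply: open_comp; last exact: box_open.
  by move=> z _; exact: initial_continuous.
move=> z U [_ [[W oW <-] Wz WU]].
have [s sz sW] := box_nbhs (open_nbhs_nbhs (conj oW Wz)).
exists (set_val @^-1` (box s)); first by split => //; exists s.
by move=> w sw; apply: WU; exact: sW.
Qed.

Lemma box_basis_le_continuum : box_basis #<= continuum_card.
Proof.
apply: card_le_trans (card_image_le _ _) _.
apply/pcard_leP/injfunPex; exists (encode slab_code) => // s t _ _.
apply: encode_inj; last exact: slab_code_inj.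
by move=> c; exists (pickle (inr c.2 : nat + rat * rat)); left.
Qed.

Lemma remainder_weight : has_weight Hstar continuum_card.
Proof.
split; last exact: continuum_le_basis.
exists box_basis; first exact: box_basisP.
by rewrite card_eq_le box_basis_le_continuum continuum_le_basis//; exact: box_basisP.
Qed.

End Weight.

(** * Continuum many functions that separate points *)

Section Separation.
Variables (R : realType) (Y : topologicalType) (y0 : Y).
Hypotheses (cY : compact [set: Y]) (hY : hausdorff_space Y).
Local Open Scope card_scope.

(** Urysohn's lemma for the closed sets [[set y0; b]] and [[set a]], where [a]
    is the one of the two points that differs from [y0]. *)
Lemma separate_points (x y : Y) : x <> y -> exists f : Y -> R,
  [/\ continuous f, forall z, 0 <= f z <= 1, f y0 = 0 & f x <> f y].
Proof.
have closed1 (z : Y) : closed [set z].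
  exact: (accessible_closed_set1 (hausdorff_accessible hY)).
have urysohn (a b : Y) : a <> b -> a <> y0 -> exists f : Y -> R,
    [/\ continuous f, forall z, 0 <= f z <= 1, f y0 = 0 & f a = 1 /\ f b = 0].
  move=> ab ay; have /(@normal_separatorP R) sep := compact_normal hY cY.
  have disj : [set y0; b] `&` [set a] = set0.
    by apply/seteqP; split=> // z [+ /= za]; rewrite za => -[/ay|/ab].
  have /(@uniform_separatorP _ R)[f [cf f01 f0 f1]] :=
    sep _ _ (closedU (closed1 y0) (closed1 b)) (closed1 a) disj.
  exists f; split=> //.
  - by move=> z; have := f01 (f z) (ex_intro2 _ _ z I erefl); rewrite /= in_itv.
  - by apply: f0; exists y0 => //; left.
  - by split; [apply: f1; exists a|apply: f0; exists b => //; right].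
move=> xy; have [xy0|xy0] := pselect (x = y0).
  have [|] := urysohn y x (fun e => xy (esym e)); first by rewrite -xy0 => /esym.
  move=> f [cf f01 fy0 [fy fx]]; exists f; split=> //.
  by rewrite fx fy => /esym/eqP; rewrite oner_eq0.
have [f [cf f01 fy0 [fx fy]]] := urysohn x y xy xy0.
by exists f; split=> //; rewrite fx fy => /eqP; rewrite oner_eq0.
Qed.

(** There are at most continuum many pairs of members of the basis, and for two
    points it suffices to separate two basic neighbourhoods. A set of natural
    numbers codes such a pair by its even and its odd elements. *)
Lemma separating_family (B : set (set Y)) : basis B -> B #<= continuum_card ->
  exists f : set nat -> Y -> R, [/\ forall k, continuous (f k),
    forall k y, 0 <= f k y <= 1, forall k, f k y0 = 0 &
    forall x y, (forall k, f k x = f k y) -> x = y].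
Proof.
move=> [Bop Bbase] /pcard_leP/injfunPex[c _ cinj].
pose fst_half (k : set nat) : set nat := [set n | k n.*2].
pose snd_half (k : set nat) : set nat := [set n | k n.*2.+1].
pose separates (k : set nat) := [set f : Y -> R |
  [/\ continuous f, forall y, 0 <= f y <= 1, f y0 = 0 &
   forall U V, B U -> B V -> c U = fst_half k -> c V = snd_half k ->
     forall u v, U u -> V v -> f u <> f v]].
pose f k : Y -> R :=
  if pselect (separates k !=set0) is left H then sval (cid H) else cst 0.
have fP k : [/\ continuous (f k), forall y, 0 <= f k y <= 1 & f k y0 = 0].
  rewrite /f; case: pselect => [H|_] /=; first by case: cid => g [].
  by split=> [y|y|//]; [exact: cvg_cst|rewrite lexx ler01].
exists f; split=> [k|k|k|x y fxy]; try by have [] := fP k.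
apply: contrapT => /separate_points[g [gc g01 gy0 gxy]].
have d0 : 0 < `|g x - g y| / 2 by rewrite divr_gt0// normr_gt0 subr_eq0; apply/eqP.
have nb z : exists2 U, B U /\ U z & forall u, U u -> `|g z - g u| < `|g x - g y| / 2.
  by have /cvgrPdist_lt/(_ _ d0)/Bbase[U BU Ug] := gc z; exists U.
have [U [BU Ux] Ug] := nb x; have [V [BV Vy] Vg] := nb y.
pose k := [set n.*2 | n in c U] `|` [set n.*2.+1 | n in c V].
have kU : fst_half k = c U.
  apply/seteqP; split=> n; last by left; exists n.
  by case=> -[m cm]; [move=> /double_inj <-|move/(congr1 odd); rewrite /= !odd_double].
have kV : snd_half k = c V.
  apply/seteqP; split=> n; last by right; exists n.
  case=> -[m cm]; first by move/(congr1 odd); rewrite /= !odd_double.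
  by case=> /double_inj <-.
have : separates k (f k).
  rewrite /f; case: pselect => [H|[]] /=; first by case: cid.
  exists g; split=> // U' V' BU' BV'; rewrite kU kV.
  move=> /cinj -> //; rewrite ?inE// => /cinj -> //; rewrite ?inE//.
  move=> u v /Ug gu /Vg gv guv; have := ler_normD (g x - g u) (g u - g y).
  by rewrite subrKA guv [`|g v - g y|]distrC -guv; move: gv; rewrite -guv; lra.
by move=> [_ _ _ /(_ U V BU BV (esym kU) (esym kV) x y Ux Vy)]; rewrite fxy.
Qed.

End Separation.

(** * The remainder maps onto continua *)

Section Visits.
Variable R : realType.

Definition visits (l : seq (rat * rat)) : set (nat -> loop R) := [set v |
  exists2 t : R, 0 <= t <= 1 & forall i, (i < size l)%N ->
    ratr (nth (0, 0) l i).1 < v i t < ratr (nth (0, 0) l i).2].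

(** Avoiding a box has to be a basic property in its own right, besides visiting
    it, because the formulas are positive. *)
Definition visit_atom (a : nat) : set (nat -> loop R) :=
  if unpickle a is Some (b, l) then if b then visits l else ~` visits l else setT.

Lemma visits_determined (l : seq (rat * rat)) (v w : nat -> loop R) :
  (forall i, (i < size l)%N -> v i = w i) -> visits l v -> visits l w.
Proof.
by move=> vw [t t01 vt]; exists t => // i il; rewrite -vw//; exact: vt.
Qed.

Lemma visit_atom_finite a : finitely_determined (visit_atom a).
Proof.
rewrite /visit_atom; case: (unpickle a) => [[[] l]|]; last by exists 0%N.
  by exists (size l) => v w; exact: visits_determined.
exists (size l) => v w vw nv wl; apply: nv; apply: visits_determined wl => i il.
by rewrite vw.
Qed.

Definition visits_on (K : choiceType) (s : seq K) (ab : K -> rat * rat)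
    (p : K -> loop R) := exists2 t : R, 0 <= t <= 1 &
  forall k, k \in s -> ratr (ab k).1 < p k t < ratr (ab k).2.

Lemma visits_onE (K : choiceType) (k0 : K) (s : seq K) (ab : K -> rat * rat)
    (p : K -> loop R) :
  visits (map ab s) (fun i => p (nth k0 s i)) <-> visits_on s ab p.
Proof.
split=> [[t t01 H]|[t t01 H]]; exists t => //.
  move=> k ks; have := H (index k s).
  by rewrite size_map index_mem (nth_map k0) ?index_mem// nth_index//; exact.
move=> i; rewrite size_map => si.
by rewrite (nth_map k0)//; apply/H/mem_nth.
Qed.

End Visits.

Section Surjection.
Variables (R : realType) (K : choiceType) (k0 : K) (lt : K -> K -> Prop).
Hypotheses (wflt : well_founded lt)
  (lt_trans : forall a b c, lt a b -> lt b c -> lt a c)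
  (lt_total : forall a b, [\/ lt a b, a = b | lt b a])
  (lt_countable : forall a, countable [set b | lt b a]).
Variables (Y : topologicalType) (y0 : Y) (f : K -> Y -> R).
Hypotheses (cY : compact [set: Y]) (connY : connected [set: Y])
  (hY : hausdorff_space Y).
Hypotheses (fcont : forall k, continuous (f k))
  (f01 : forall k y, 0 <= f k y <= 1) (fy0 : forall k, f k y0 = 0)
  (fsep : forall x y, (forall k, f k x = f k y) -> x = y).
Local Notation Hstar := (half_line_remainder R).

(** A generic family of loops, satisfying all these finite conditions, is to be
    imagined as infinitely close to the image of [Y] in all coordinates and
    passing through every point of this image. *)
Definition good_loops (i : seq K * R * seq Y) : set (K -> loop R) := [set p |
  (forall t, near_image f i.1.1 i.1.2 (fun k => p k t)) /\
  forall y, y \in i.2 -> exists2 t : R, 0 <= t <= 1 & forall k, p k t = f k y].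

Definition loop_filter := filter_from [set i | 0 < i.1.2] good_loops.

#[local] Instance loop_filter_proper : ProperFilter loop_filter.
Proof.
apply: filter_from_proper => [|[[s e] ys] /= e0].
  apply: filter_from_filter; first by exists ([::], 1, [::]) => /=; exact: ltr01.
  move=> [[s e] ys] [[s' e'] ys'] /= e0 e0'.
  exists (s ++ s', Num.min e e', ys ++ ys'); first by rewrite /= lt_min e0.
  move=> p [/= pi py]; split; split=> /= [t|y yy].
  - have [w wP] := pi t; exists w => k ks.
    by have := wP k; rewrite mem_cat ks lt_min => /(_ isT)/andP[].
  - by apply: py; rewrite mem_cat yy.
  - have [w wP] := pi t; exists w => k ks.
    by have := wP k; rewrite mem_cat ks orbT lt_min => /(_ isT)/andP[].
  - by apply: py; rewrite mem_cat yy orbT.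
exact: (loops_through fcont f01 connY s e0 ys fy0).
Qed.

(** Formulas serve to construct the sequences [h]; the boxes visited and avoided
    are all that matters to define the map onto [Y]. *)
Definition coherent (h : K -> nat -> loop R) :=
  forall s ab,
  (loop_filter [set p | visits_on s ab p] ->
   \forall n \near \oo, visits_on s ab (h^~ n)) /\
  (loop_filter [set p | ~ visits_on s ab p] ->
   \forall n \near \oo, ~ visits_on s ab (h^~ n)).

Lemma coherent_loops : exists h : K -> nat -> loop R, coherent h.
Proof.
have [h hP] := coherent_sequences (flat R) (@visit_atom_finite R)
  (FF := loop_filter_proper) wflt lt_trans lt_total lt_countable.
exists h => s ab.
have PE (p : K -> loop R) :
    visits_on s ab p <-> visits (map ab s) (fun i => p (nth k0 s i)).
  by apply: iff_sym; exact: visits_onE.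
split=> FP.
  have := hP (pickle (true, map ab s)) (nth k0 s).
  rewrite /visit_atom pickleK => -[|N _ HN].
    by apply: filterS FP => p /PE.
  by exists N => // n /HN /(PE (h^~ n)).
have := hP (pickle (false, map ab s)) (nth k0 s).
rewrite /visit_atom pickleK => -[|N _ HN].
  by apply: filterS FP => p nP /PE.
by exists N => // n /HN nv /(PE (h^~ n)).
Qed.

Section Limits.
Variable h : K -> nat -> loop R.
Hypothesis hP : coherent h.

Let c k : Hstar -> R := fun z => cube_coord (coord_concat (h k)) (set_val z).

Lemma c_continuous k : continuous (c k).
Proof.
move=> z; apply: (@continuous_comp _ _ _ set_val (cube_coord _)).
  exact: initial_continuous.
exact: coord_continuous.
Qed.

(** In other words, the compact image of [Y] in the product is closed. *)
Lemma image_closed (v : K -> R) :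
  (forall (s : seq K) d, 0 < d -> exists y, forall k, k \in s -> `|f k y - v k| < d) ->
  exists y, forall k, f k y = v k.
Proof.
move=> vP.
pose D (i : seq K * R) := [set y | forall k, k \in i.1 -> `|f k y - v k| < i.2].
pose F := filter_from [set i | 0 < i.2] D.
have FF : ProperFilter F.
  apply: filter_from_proper => [|[s d] /= d0]; last exact: vP.
  apply: filter_from_filter; first by exists ([::], 1) => /=; exact: ltr01.
  move=> [s d] [s' d'] /= d0 d0'.
  exists (s ++ s', Num.min d d'); first by rewrite /= lt_min d0.
  move=> y yP; split=> k ks; have := yP k; rewrite /= mem_cat ks ?orbT lt_min;
    by move=> /(_ isT)/andP[].
have [|y [_ cly]] := cY FF; first exact: filterT.
exists y => k; apply: (cluster_limit (@fcont k) cly).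
apply/cvgrPdist_lt => e e0; exists ([:: k], e) => // w; rewrite distrC.
by apply; rewrite mem_head.
Qed.

(** If the point with coordinates [c k z] were not in the image of [Y], then a
    rational box around it would be at a positive distance from this image, so
    that generic loops and hence almost all the loops [h^~ n] would avoid this
    box; but the half line comes back to it arbitrarily far. *)
Lemma remainder_value z : exists y, forall k, f k y = c k z.
Proof.
apply: image_closed => s d d0; apply: contrapT => /forallNP nvis.
have d20 : 0 < d / 2 by rewrite divr_gt0.
have /choice[ab abP] : forall k, exists ab : rat * rat,
    ratr ab.1 < c k z < ratr ab.2 /\
    (c k z - d / 2 < ratr ab.1) && (ratr ab.2 < c k z + d / 2).
  by move=> k; have [a [b abP]] := rat_approx (c k z) d20; exists (a, b).
have [|N _ HN] := (hP s ab).2.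
  exists (s, d / 2, [::]) => // p [pi _] [t _ pt]; have [w wP] := pi t.
  apply: (nvis w) => k ks; have /= := wP k ks; have := pt k ks.
  have [_ /andP[a1 a2]] := abP k; rewrite ltr_norml => /andP[p1 p2] /andP[w1 w2].
  by rewrite ltr_norml; apply/andP; split; lra.
pose l := [seq (coord_concat (h k), ab k) | k <- s].
have [|t Nt tl] := @remainder_witness R z (box l) N.
  apply: open_nbhs_nbhs; split; first exact: box_open.
  by move=> _ /mapP[k ks ->] /=; have [] := abP k.
have t0 : 0 <= t by apply: le_trans Nt.
have /andP[nt tn] := truncn_itv t0; rewrite -[(Num.truncn t).+1%:R]natr1 in tn.
have t01 : 0 <= t - (Num.truncn t)%:R <= 1 by apply/andP; split; lra.
apply: (HN (Num.truncn t)); first by rewrite /= truncn_ge_nat.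
exists (t - (Num.truncn t)%:R) => // k ks; rewrite -coord_concatE// subrKC.
exact: (tl (_, _) (map_f _ ks)).
Qed.

(** The rational boxes around [y] are visited by all the loops [h^~ n] with [n]
    large, which yields a filter going to infinity along which the coordinates
    tend to those of [y]. *)
Lemma remainder_value_onto y : exists z, forall k, f k y = c k z.
Proof.
pose D (i : seq K * R * nat) := [set t : R | i.2%:R <= t /\
  forall k, k \in i.1.1 -> `|cube_coord (coord_concat (h k)) (ray t) - f k y| < i.1.2].
pose F := filter_from [set i | 0 < i.1.2] D.
have FF : ProperFilter F.
  apply: filter_from_proper => [|[[s d] N] /= d0].
    apply: filter_from_filter; first by exists ([::], 1, 0%N) => /=; exact: ltr01.
    move=> [[s d] N] [[s' d'] N'] /= d0 d0'.
    exists (s ++ s', Num.min d d', maxn N N'); first by rewrite /= lt_min d0.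
    move=> t [/=]; rewrite natr_max ge_max => /andP[Nt N't] tP.
    split; split=> //= k ks; have := tP k; rewrite mem_cat ks ?orbT lt_min;
      by move=> /(_ isT)/andP[].
  have /choice[ab abP] : forall k, exists ab : rat * rat,
      ratr ab.1 < f k y < ratr ab.2 /\
      (f k y - d < ratr ab.1) && (ratr ab.2 < f k y + d).
    by move=> k; have [a [b abP]] := rat_approx (f k y) d0; exists (a, b).
  have [|M _ HM] := (hP s ab).1.
    exists ([::], 1, [:: y]); first exact: ltr01.
    move=> p [_ /(_ y (mem_head _ _))[t t01 pt]]; exists t => // k ks.
    by rewrite pt; have [] := abP k.
  have [t t01 tP] := HM _ (leq_maxl M N).
  exists ((maxn M N)%:R + t); split=> /= [|k ks].
    have : (N%:R : R) <= (maxn M N)%:R by rewrite ler_nat leq_maxr.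
    by case/andP: t01; lra.
  rewrite coord_concatE//; have /andP[p1 p2] := tP k ks.
  have [_ /andP[a1 a2]] := abP k; rewrite ltr_norml; apply/andP; split; lra.
have [|z clz] := remainder_cluster FF.
  move=> N; exists ([::], 1, N); first exact: ltr01.
  by move=> t [/=]; rewrite in_itv /= andbT.
exists z => k; apply/esym/(cluster_limit (@coord_continuous R _ _) clz).
apply/cvgrPdist_lt => e e0; exists ([:: k], e, 0%N) => // t [_ tP].
by rewrite /= distrC; apply: tP; rewrite mem_head.
Qed.

(** In a compact Hausdorff space it is enough to identify the cluster points,
    and continuous functions that separate points identify them. *)
Lemma remainder_value_continuous (g : Hstar -> Y) :
  (forall z k, f k (g z) = c k z) -> continuous g.
Proof.
move=> gP z; have gz := fmap_proper_filter g (nbhs_pfilter z).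
apply: (compact_cluster_set1 hY cY filterT gz filterT).
have sub y : cluster (g @ z) y -> y = g z.
  move=> cly; apply: fsep => k; apply: (cluster_limit (@fcont k) cly).
  have fg : f k \o g = c k by apply/funext => w; rewrite /= gP.
  have : (f k \o g) @ z --> c k z by rewrite fg; exact: c_continuous.
  by rewrite gP.
have [y [_ cly]] := cY gz filterT.
by apply/seteqP; split=> [w /sub//|_ ->]; rewrite -(sub _ cly).
Qed.

End Limits.

Lemma remainder_onto : exists2 g : Hstar -> Y, continuous g & range g = [set: Y].
Proof.
have [h hP] := coherent_loops.
have /choice[g gP] := remainder_value hP.
exists g; first exact: remainder_value_continuous gP.
apply/seteqP; split=> // y _; have [z zP] := remainder_value_onto hP y.
by exists z => //; apply: fsep => k; rewrite gP zP.
Qed.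

End Surjection.

Theorem theorem2 (R : realType) :
  continuum_hypothesis ->
  universal_continuum continuum_card (half_line_remainder R).
Proof.
move=> CH; split=> [||Y [[y0 _] cY connY hY] [[B Bbase BK] _]].
- exact: remainder_continuum.
- exact: remainder_weight.
have [lt [wflt lt_trans lt_total lt_countable]] := ch_order CH.
have BK' : (B #<= continuum_card)%card by move: BK; rewrite card_eq_le => /andP[].
have [f [fcont f01 fy0 fsep]] := separating_family R y0 cY hY Bbase BK'.
exact: (remainder_onto (set0 : set nat) wflt lt_trans lt_total lt_countable
  cY connY hY fcont f01 fy0 fsep).
Qed.
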